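(* In the category $\mathbf{Raney}_{\mathcal{E}}$, every Raney extension $(L,C)$ such that the frame $L$ is subfit admits a $T_1$ reflection, and this coincides with its $T_D$ reflection.
   Context: A frame $L$ is subfit if whenever $x\not\le y$ in $L$ there is $u\in L$ with $x\vee u=1$ and $y\vee u\neq 1$. A Raney extension is a pair $(L,C)$ where $C$ is a coframe, $L\subseteq C$ is a frame such that every element of $C$ is a meet of elements of $L$, and the inclusion preserves arbitrary joins, finite meets, and strongly exact meets of $L$ (a meet $\bigwedge_i x_i$ in $L$ is strongly exact if for all $y\in L$, $x_i\to y=y$ for all $i$ implies $(\bigwedge_i x_i)\to y=y$). A morphism $f:(L,C)\to(M,D)$ of Raney extensions is a coframe map $f:C\to D$ (preserving arbitrary meets and finite joins) with $f[L]\subseteq M$ whose restriction $f|_L:L\to M$ is a frame map. A meet $\bigwedge_i x_i$ in a frame $L$ is exact if $(\bigwedge_i x_i)\vee a=\bigwedge_i(x_i\vee a)$ for all $a\in L$. A frame map $g:L\to M$ is exact if for every exact meet $\bigwedge_i x_i$ in $L$, the meet $\bigwedge_i g(x_i)$ is exact and equals $g(\bigwedge_i x_i)$. $\mathbf{Raney}_{\mathcal{E}}$ is the category of Raney extensions with morphisms whose restriction to the frame components is exact. A Raney extension $(L,C)$ is $T_1$ if $C$ is a Boolean algebra. It is $T_D$ if each element of $C$ is a join of elements of the form $\bigwedge F$ (meet in $C$) with $F$ an exact filter of $L$ (a filter closed under exact meets). A $T_1$ reflection (respectively $T_D$ reflection) of $(L,C)$ in $\mathbf{Raney}_{\mathcal{E}}$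 is a morphism $\tau:(L,C)\to T(L,C)$ of $\mathbf{Raney}_{\mathcal{E}}$ such that $T(L,C)$ is $T_1$ (respectively $T_D$), and such that every morphism $f:(L,C)\to(M,D)$ of $\mathbf{Raney}_{\mathcal{E}}$ into a $T_1$ (respectively $T_D$) Raney extension factors as $f=f_\tau\circ\tau$ for some morphism $f_\tau:T(L,C)\to(M,D)$ of $\mathbf{Raney}_{\mathcal{E}}$. *)

(* Defs.v *)
From HB Require Import structures.
From mathcomp Require Import all_boot all_order.
From mathcomp Require Import boolp classical_sets.

Set Implicit Arguments.
Unset Strict Implicit.
Unset Printing Implicit Defensive.

Import Order.TTheory.

Local Open Scope classical_set_scope.
Local Open Scope order_scope.

(** Complete lattices, frames and coframes.  Families [(x_i)_i] of elements are
    represented by the set of their values. *)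

HB.mixin Record isCompleteLattice d T of Order.TBLattice d T := {
  bigjoin : set T -> T;
  bigmeet : set T -> T;
  bigjoinP : forall A : set T, supremums A (bigjoin A);
  bigmeetP : forall A : set T, infimums A (bigmeet A)
}.

#[short(type="completeLatticeType")]
HB.structure Definition CompleteLattice d :=
  { T of isCompleteLattice d T & Order.TBLattice d T }.

HB.mixin Record isFrame d T of CompleteLattice d T := {
  meet_bigjoin : forall (x : T) (A : set T),
    Order.meet x (bigjoin A) = bigjoin [set Order.meet x a | a in A]
}.

#[short(type="frameType")]
HB.structure Definition Frame d := { T of isFrame d T & CompleteLattice d T }.

HB.mixin Record isCoframe d T of CompleteLattice d T := {
  join_bigmeet : forall (x : T) (A : set T),
    Order.join x (bigmeet A) = bigmeet [set Order.join x a | a in A]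
}.

#[short(type="coframeType")]
HB.structure Definition Coframe d := { T of isCoframe d T & CompleteLattice d T }.

Definition subfit d (L : frameType d) : Prop :=
  forall x y : L, ~ (x <= y) ->
    exists u : L, Order.join x u = \top /\ Order.join y u <> \top.

(* The Heyting implication of a frame. *)
Definition himp d (L : frameType d) (x y : L) : L :=
  bigjoin [set z | Order.meet x z <= y].

(* [exact_meet A]: the meet of [A] in [L] is exact. *)
Definition exact_meet d (L : frameType d) (A : set L) : Prop :=
  forall a : L,
    Order.join (bigmeet A) a = bigmeet [set Order.join x a | x in A].

Definition strongly_exact_meet d (L : frameType d) (A : set L) : Prop :=
  forall y : L, (forall x, A x -> himp x y = y) -> himp (bigmeet A) y = y.

(* Filters may be improper. *)
Record is_filter d (L : frameType d) (F : set L) : Prop := IsFilter {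
  filter_top : F \top;
  filter_meet : forall x y, F x -> F y -> F (Order.meet x y);
  filter_up : forall x y, x <= y -> F x -> F y
}.

Record exact_filter d (L : frameType d) (F : set L) : Prop := ExactFilter {
  exact_filter_filter : is_filter F;
  exact_filter_meet : forall A : set L, A `<=` F -> exact_meet A -> F (bigmeet A)
}.

Record frame_map d d' (L : frameType d) (M : frameType d') (g : L -> M) : Prop :=
  FrameMap {
    frame_map_bigjoin : forall A : set L, g (bigjoin A) = bigjoin (g @` A);
    frame_map_top : g \top = \top;
    frame_map_meet : {morph g : x y / Order.meet x y}
  }.

Record coframe_map d d' (C : coframeType d) (D : coframeType d') (f : C -> D) :
    Prop := CoframeMap {
  coframe_map_bigmeet : forall A : set C, f (bigmeet A) = bigmeet (f @` A);
  coframe_map_bot : f \bot = \bot;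
  coframe_map_join : {morph f : x y / Order.join x y}
}.

Definition exact_map d d' (L : frameType d) (M : frameType d') (g : L -> M) :
    Prop :=
  forall A : set L, exact_meet A ->
    exact_meet (g @` A) /\ bigmeet (g @` A) = g (bigmeet A).

(** The inclusion of [L] in [C] is an injection [incl]; since it preserves
    binary meets, the order of [L] is the one induced by [C].  The meets of [L]
    are taken in [L] itself: only the finite and the strongly exact ones are
    required to agree with those of [C]. *)
Record raney_ext := RaneyExt {
  frame_disp : Order.disp_t;
  coframe_disp : Order.disp_t;
  frame_of : frameType frame_disp;
  coframe_of : coframeType coframe_disp;
  incl : frame_of -> coframe_of;
  incl_inj : injective incl;
  incl_generates : forall c : coframe_of,
    exists A : set frame_of, c = bigmeet (incl @` A);
  incl_bigjoin : forall A : set frame_of,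
    incl (bigjoin A) = bigjoin (incl @` A);
  incl_top : incl \top = \top;
  incl_meet : {morph incl : x y / Order.meet x y};
  incl_strongly_exact : forall A : set frame_of, strongly_exact_meet A ->
    incl (bigmeet A) = bigmeet (incl @` A)
}.

Arguments incl : clear implicits.

(* [hom_restr] is the restriction of [hom_fun] to the frame components; it is
   determined by [hom_fun], as [incl Y] is injective. *)
Record raney_hom (X Y : raney_ext) := RaneyHom {
  hom_fun :> coframe_of X -> coframe_of Y;
  hom_restr : frame_of X -> frame_of Y;
  hom_coframe_map : coframe_map hom_fun;
  hom_restrE : forall x, hom_fun (incl X x) = incl Y (hom_restr x);
  hom_frame_map : frame_map hom_restr
}.

(* The morphisms of the category Raney_E. *)
Definition exact_hom (X Y : raney_ext) (f : raney_hom X Y) : Prop :=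
  exact_map (hom_restr f).

(* The coframe is distributive, so it is Boolean when it is complemented. *)
Definition raney_T1 (X : raney_ext) : Prop :=
  forall c : coframe_of X, exists c' : coframe_of X,
    Order.meet c c' = \bot /\ Order.join c c' = \top.

Definition raney_TD (X : raney_ext) : Prop :=
  forall c : coframe_of X, exists S : set (set (frame_of X)),
    (forall F, S F -> exact_filter F) /\
    c = bigjoin [set bigmeet (incl X @` F) | F in S].

(* [tau : X -> T] is a reflection of [X] in Raney_E, along the extensions
   satisfying [P]. *)
Definition reflection_E (P : raney_ext -> Prop) (X T : raney_ext)
    (tau : raney_hom X T) : Prop :=
  [/\ exact_hom tau, P T &
    forall (Y : raney_ext) (f : raney_hom X Y), exact_hom f -> P Y ->
      exists2 f_tau : raney_hom T Y, exact_hom f_tau & f =1 f_tau \o tau].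

(* Main.v *)
Require Import Defs.
From HB Require Import structures.
From mathcomp Require Import all_boot all_order.
From mathcomp Require Import boolp classical_sets.

(** In a coframe [C] with a generating frame [L], let [b \ a] be the least [c]
    with [b <= a \/ c].  For [a], [b] in [L], an element [z] of [L] lies above
    [b \ a] iff [b <= z \/ a], a condition that every exact meet respects.
    Conversely, every exact filter of [L] is an intersection of filters of this
    shape ([exact_filter_closed]).  So the joins of differences [b \ a] are the
    elements of [C] that exact filters can see, and whether a morphism into a
    T_D extension can separate two elements of [C] depends on exact filters
    only.

    Let [core c] be the join of the differences below [c].  It is an interior
    operator, and it preserves finite joins: [b \ a <= c \/ e] means
    [(b \ a) \ c <= e], and as [c] is a meet of elements [x] of [L], the left
    side is a join of differences [b \ (a \/ x)], all of which lie below
    [core e] as soon as they lie below [e].  So the fixed points of [core] form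
    a coframe, with [core] as a coframe map onto it; they contain [L], and they
    give a Raney extension [core_ext X], which is T_D by construction.

    A morphism [f], exact on [L], into a T_D extension satisfies
    [f (core c) = f c] ([hom_core]): if [G] is an exact filter of the target
    whose meet lies below [f c], then the preimage of [G] in [L] is an exact
    filter which contains every [x >= c], hence every [x >= core c].  Therefore
    [f] factors through [core] by its restriction to the fixed points, and
    [core_ext X] is the T_D reflection of any [X].

    If [L] is subfit, every nonzero difference dominates a nonzero difference
    [1 \ v], and this makes the fixed points of [core] complemented
    ([core_ext_T1]).  Since T_1 extensions are T_D ([T1_TD]), the T_D reflection
    is then also the T_1 reflection. *)

Set Implicit Arguments.
Unset Strict Implicit.
Unset Printing Implicit Defensive.

Import Order.TTheory.

Local Open Scope classical_set_scope.
Local Open Scope order_scope.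

(** * Complete lattices *)

Section CompleteLatticeTheory.
Context {d : Order.disp_t} {T : completeLatticeType d}.
Implicit Types (x y z : T) (A B : set T).

Lemma bigjoin_ub A x : A x -> x <= bigjoin A.
Proof. by case: (bigjoinP A) => ub _; apply: ub. Qed.

Lemma bigjoin_le A z : (forall x, A x -> x <= z) -> bigjoin A <= z.
Proof. by case: (bigjoinP A) => _; apply. Qed.

Lemma bigmeet_lb A x : A x -> bigmeet A <= x.
Proof. by case: (bigmeetP A) => lb _; apply: lb. Qed.

Lemma bigmeet_ge A z : (forall x, A x -> z <= x) -> z <= bigmeet A.
Proof. by case: (bigmeetP A) => _; apply. Qed.

Lemma bigmeet_anti A B : A `<=` B -> bigmeet B <= bigmeet A.
Proof. by move=> AB; apply: bigmeet_ge => x /AB; apply: bigmeet_lb. Qed.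

Lemma bigjoin_set0 : bigjoin set0 = \bot :> T.
Proof. by apply/eqP; rewrite -lex0; apply: bigjoin_le. Qed.

Lemma bigjoin_set2 x y : bigjoin [set x; y] = Order.join x y.
Proof.
apply/le_anti/andP; split.
  by apply: bigjoin_le => z [->|->]; rewrite ?leUl ?leUr.
by rewrite leUx !bigjoin_ub //=; [right|left].
Qed.

Lemma bigmeet_set2 x y : bigmeet [set x; y] = Order.meet x y.
Proof.
apply/le_anti/andP; split.
  by rewrite lexI !bigmeet_lb //=; [right|left].
by apply: bigmeet_ge => z [->|->]; rewrite ?leIl ?leIr.
Qed.

End CompleteLatticeTheory.

(** * Differences in a coframe *)

Section CoframeTheory.
Context {d : Order.disp_t} {C : coframeType d}.
Implicit Types (a b c : C).

Lemma join_meetr a b c :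
  Order.join a (Order.meet b c) = Order.meet (Order.join a b) (Order.join a c).
Proof. by rewrite -!bigmeet_set2 join_bigmeet image_setU !image_set1. Qed.

Definition cdiff b a : C := bigmeet [set c | b <= Order.join a c].

(** Joining with [a] preserves all meets, so it has a left adjoint. *)
Lemma cdiff_le b a c : (cdiff b a <= c) = (b <= Order.join a c).
Proof.
apply/idP/idP => [le_c|]; last by move=> ?; apply: bigmeet_lb.
apply: (@le_trans _ _ (Order.join a (cdiff b a))); last exact: leU2.
by rewrite join_bigmeet; apply: bigmeet_ge => _ [z /= ? <-].
Qed.

End CoframeTheory.

(** * Coframes of fixed points *)

Record conucleus d (C : coframeType d) := Conucleus {
  conucleus_fun :> C -> C;
  conucleus_le : forall c, conucleus_fun c <= c;
  conucleusK : forall c, conucleus_fun (conucleus_fun c) = conucleus_fun c;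
  conucleusU : {morph conucleus_fun : x y / Order.join x y}
}.

Record fixpoints d (C : coframeType d) (k : conucleus C) := FixedPoint {
  fix_val : C;
  fix_valP : k fix_val == fix_val
}.

Section Fixpoints.
Context {d : Order.disp_t} {C : coframeType d} (k : conucleus C).
Notation T := (fixpoints k).

HB.instance Definition _ := [isSub of T for @fix_val d C k].
HB.instance Definition _ := [Choice of T by <:].
HB.instance Definition _ := [SubChoice_isSubPOrder of T by <: with d].

Implicit Types (s t : T) (A : set T).

Lemma conucleus_mono : {homo k : x y / x <= y}.
Proof. by move=> x y /join_idPl xy; rewrite -xy conucleusU leUr. Qed.

Lemma fixpointE t : k (val t) = val t.
Proof. exact/eqP/(valP t). Qed.

(** The projection onto the fixed points is right adjoint to their inclusion:
    this is why meets of fixed points are projected meets, whereas joins are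
    those of [C]. *)
Lemma fixpoint_le t c : (val t <= k c) = (val t <= c).
Proof.
apply/idP/idP => [le_k|le_c]; first exact: le_trans le_k (conucleus_le k c).
by rewrite -fixpointE conucleus_mono.
Qed.

Definition fix_proj (c : C) : T := FixedPoint (introT eqP (conucleusK k c)).

Lemma val_fix_proj c : val (fix_proj c) = k c.
Proof. by []. Qed.

Lemma fix_projK : cancel val fix_proj.
Proof. by move=> t; apply: val_inj; rewrite /= fixpointE. Qed.

Lemma le_fix_proj t c : (t <= fix_proj c) = (val t <= c).
Proof. exact: fixpoint_le. Qed.

Lemma fix_joinP s t :
  k (Order.join (val s) (val t)) == Order.join (val s) (val t).
Proof. by rewrite conucleusU !fixpointE. Qed.

Definition fix_join s t : T := FixedPoint (fix_joinP s t).

Lemma fix_bigjoinP A : k (bigjoin (val @` A)) == bigjoin (val @` A).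
Proof.
rewrite eq_le conucleus_le; apply: bigjoin_le => _ [t At <-].
by rewrite fixpoint_le; apply: bigjoin_ub; exists t.
Qed.

Definition fix_bigjoin A : T := FixedPoint (fix_bigjoinP A).

Lemma fix_lexI r s t :
  (r <= fix_proj (Order.meet (val s) (val t))) = (r <= s) && (r <= t).
Proof. by rewrite le_fix_proj lexI. Qed.

Lemma fix_leUx r s t : (fix_join r s <= t) = (r <= t) && (s <= t).
Proof. exact: leUx. Qed.

HB.instance Definition _ := Order.POrder_MeetJoin_isLattice.Build d T
  fix_lexI fix_leUx.

Lemma fix_le0x t : fix_proj \bot <= t.
Proof. exact: le_trans (conucleus_le _ _) (le0x _). Qed.

Lemma fix_lex1 t : t <= fix_proj \top.
Proof. by rewrite le_fix_proj lex1. Qed.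

HB.instance Definition _ := Order.hasBottom.Build d T fix_le0x.
HB.instance Definition _ := Order.hasTop.Build d T fix_lex1.

Lemma fix_bigjoin_sup A : supremums A (fix_bigjoin A).
Proof.
split=> [t At|t ub_t]; first by apply: (@bigjoin_ub _ C); exists t.
by apply: (@bigjoin_le _ C) => _ [s As <-]; apply: ub_t.
Qed.

Lemma fix_bigmeet_inf A : infimums A (fix_proj (bigmeet (val @` A))).
Proof.
split=> [t At|t lb_t].
  apply: (le_trans (conucleus_le k _)).
  by apply: bigmeet_lb; exists t.
by rewrite le_fix_proj; apply: bigmeet_ge => _ [s As <-]; apply: lb_t.
Qed.

HB.instance Definition _ :=
  isCompleteLattice.Build d T fix_bigjoin_sup fix_bigmeet_inf.

Lemma val_fixU s t : val (Order.join s t) = Order.join (val s) (val t).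
Proof. by []. Qed.

Lemma val_fix_bigjoin A : val (bigjoin A) = bigjoin (val @` A).
Proof. by []. Qed.

Lemma fix_proj_bigmeet (A : set C) :
  fix_proj (bigmeet A) = bigmeet (fix_proj @` A).
Proof.
apply/le_anti/andP; split.
  apply: bigmeet_ge => _ [c Ac <-].
  by rewrite le_fix_proj (le_trans (conucleus_le _ _)) // bigmeet_lb.
rewrite le_fix_proj; apply: bigmeet_ge => c Ac; rewrite -le_fix_proj.
by apply: bigmeet_lb; exists c.
Qed.

Lemma fix_projU : {morph fix_proj : c e / Order.join c e}.
Proof. by move=> c e; apply: val_inj; rewrite /= conucleusU. Qed.

(** The projection preserves binary joins and all meets, so the coframe law
    descends from [C]. *)
Lemma fix_join_bigmeet t A :
  Order.join t (bigmeet A) = bigmeet [set Order.join t s | s in A].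
Proof.
have -> : bigmeet A = fix_proj (bigmeet (val @` A)) by [].
rewrite -{1}[t]fix_projK -fix_projU join_bigmeet fix_proj_bigmeet.
rewrite !image_comp; congr bigmeet; apply: eq_imagel => s As /=.
by rewrite -val_fixU fix_projK.
Qed.

HB.instance Definition _ := isCoframe.Build d T fix_join_bigmeet.

Lemma fix_proj_coframe_map : coframe_map fix_proj.
Proof. by split=> //; [exact: fix_proj_bigmeet|exact: fix_projU]. Qed.

End Fixpoints.

(** * Exact filters of a Raney extension *)

Section RaneyTheory.
Variable X : raney_ext.
Notation L := (frame_of X).
Notation C := (coframe_of X).
Notation i := (incl X).
Implicit Types (a b x y z u : L) (c e : C) (E : set L).

Lemma le_incl x y : (i x <= i y) = (x <= y).
Proof. by rewrite !leEmeet -incl_meet (inj_eq (@incl_inj X)). Qed.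

Lemma inclU x y : i (Order.join x y) = Order.join (i x) (i y).
Proof. by rewrite -!bigjoin_set2 incl_bigjoin image_setU !image_set1. Qed.

Lemma incl0 : i \bot = \bot.
Proof. by rewrite -!bigjoin_set0 incl_bigjoin image_set0. Qed.

Lemma bigmeet_above c : bigmeet (i @` [set x | c <= i x]) = c.
Proof.
apply/le_anti/andP; split; last by apply: bigmeet_ge => _ [x /= ? <-].
have [A cE] := incl_generates c; rewrite {2}cE; apply: bigmeet_anti.
by move=> _ [x Ax <-]; exists x => //=; rewrite cE; apply: bigmeet_lb; exists x.
Qed.

Lemma le_bigmeet_above c e : (forall x, c <= i x -> e <= i x) -> e <= c.
Proof.
move=> le_e; rewrite -(bigmeet_above c).
by apply: bigmeet_ge => _ [x /le_e ? <-].
Qed.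

Lemma cdiff_incl_le b a z :
  (cdiff (i b) (i a) <= i z) = (b <= Order.join z a).
Proof. by rewrite cdiff_le -inclU le_incl joinC. Qed.

Lemma exact_filter_cdiff b a :
  exact_filter [set z | cdiff (i b) (i a) <= i z].
Proof.
split; first split=> /=.
- by rewrite incl_top lex1.
- by move=> x y; rewrite incl_meet lexI => -> ->.
- by move=> x y; rewrite -le_incl => xy /le_trans; apply.
move=> A subA exA /=; rewrite cdiff_incl_le exA.
by apply: bigmeet_ge => _ [x /subA /= Ax <-]; rewrite -cdiff_incl_le.
Qed.

(** An exact filter is an intersection of filters, each consisting of the
    [z] with [b <= z \/ a] for some [a] and [b].  The hypothesis says precisely
    that the meet of the elements [z \/ x], for [z] in [E], is [x] and is
    exact. *)
Lemma exact_filter_closed E x : exact_filter E ->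
    (forall a b, (forall z, E z -> b <= Order.join z a) ->
      b <= Order.join x a) ->
  E x.
Proof.
move=> [[E1 _ Eup] EI] xE; pose A := [set Order.join z x | z in E].
have Ax : bigmeet A = x.
  apply/le_anti/andP; split; last first.
    by apply: bigmeet_ge => _ [z _ <-]; exact: leUr.
  (* Take a := x and b := bigmeet A. *)
  rewrite -[leRHS]joinxx; apply: xE => z Ez.
  by apply: bigmeet_lb; exists z.
rewrite -Ax; apply: EI; first by move=> _ [z Ez <-]; apply: Eup Ez; exact: leUl.
move=> a; rewrite Ax; apply/le_anti/andP; split.
  by apply: bigmeet_ge => _ [_ [z _ <-] <-]; rewrite leU2 // leUr.
(* Take x \/ a for a, and the meet on the left for b. *)
have -> : Order.join x a = Order.join x (Order.join x a).
  by rewrite joinA joinxx.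
apply: xE => z Ez; rewrite joinA.
by apply: bigmeet_lb; exists (Order.join z x) => //; exists z.
Qed.

(** * The core of an element *)

Definition core_fun c : C :=
  bigjoin [set e | exists a b, e = cdiff (i b) (i a) /\ e <= c].

Lemma core_fun_le c : core_fun c <= c.
Proof. by apply: bigjoin_le => _ [a [b [-> ]]]. Qed.

Lemma cdiff_le_core b a c :
  (cdiff (i b) (i a) <= core_fun c) = (cdiff (i b) (i a) <= c).
Proof.
apply/idP/idP => [/le_trans|le_c]; first by apply; exact: core_fun_le.
by apply: bigjoin_ub; exists a, b.
Qed.

Lemma core_fun_leP c e :
  (forall a b, cdiff (i b) (i a) <= c -> cdiff (i b) (i a) <= e) ->
  core_fun c <= e.
Proof. by move=> le_e; apply: bigjoin_le => _ [a [b [-> /le_e]]]. Qed.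

Lemma core_fun_mono : {homo core_fun : c e / c <= e}.
Proof.
move=> c e ce; apply: core_fun_leP => a b le_c.
by rewrite cdiff_le_core (le_trans le_c).
Qed.

Lemma core_funK c : core_fun (core_fun c) = core_fun c.
Proof.
apply/le_anti; rewrite core_fun_le /=.
by apply: core_fun_leP => a b; rewrite !cdiff_le_core.
Qed.

(** Writing [c] as a meet of elements [x] of [L] reduces the claim to
    [c = i x], where the hypothesis reads [cdiff (i b) (i (a \/ x)) <= e]. *)
Lemma cdiff_le_joinr_core b a c e :
  cdiff (i b) (i a) <= Order.join c e ->
  cdiff (i b) (i a) <= Order.join c (core_fun e).
Proof.
rewrite !cdiff_le => le_ce.
rewrite joinA (joinC (i a)) -joinA joinC -(bigmeet_above c) join_bigmeet.
apply: bigmeet_ge => _ [_ [x /= cx <-] <-].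
rewrite joinC joinA (joinC (i x)) -inclU -cdiff_le cdiff_le_core cdiff_le inclU.
by apply: le_trans le_ce _; rewrite -joinA leU2 // leU2.
Qed.

Lemma core_funU : {morph core_fun : c e / Order.join c e}.
Proof.
move=> c e; apply/le_anti/andP; split; last first.
  by rewrite leUx !core_fun_mono ?leUl ?leUr.
apply: core_fun_leP => a b /cdiff_le_joinr_core; rewrite joinC.
by move=> /cdiff_le_joinr_core; rewrite joinC.
Qed.

Definition core : conucleus C := Conucleus core_fun_le core_funK core_funU.

Lemma core_cdiff b a : core (cdiff (i b) (i a)) = cdiff (i b) (i a).
Proof. by apply/le_anti; rewrite conucleus_le /= cdiff_le_core. Qed.

Lemma core_incl x : core (i x) = i x.
Proof.
suff -> : i x = cdiff (i x) (i \bot) by rewrite core_cdiff.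
apply/le_anti; rewrite cdiff_incl_le joinx0 lexx andbT.
by apply: le_bigmeet_above => z; rewrite cdiff_incl_le joinx0 le_incl.
Qed.

(** The differences below the meet of [E] decide membership in [E]. *)
Lemma mem_exact_filter_core E x : exact_filter E ->
  core (bigmeet (i @` E)) <= i x -> E x.
Proof.
move=> exE le_x; apply: exact_filter_closed exE _ => a b le_b.
rewrite -cdiff_incl_le; apply: le_trans le_x; rewrite cdiff_le_core.
by apply: bigmeet_ge => _ [z Ez <-]; rewrite cdiff_incl_le le_b.
Qed.

Lemma mem_exact_filter E x : exact_filter E -> bigmeet (i @` E) <= i x -> E x.
Proof.
move=> exE le_x; apply: mem_exact_filter_core exE _.
exact: le_trans (conucleus_le _ _) le_x.
Qed.

(** * The Raney extension of core elements *)

Definition core_incl_fun x : fixpoints core := fix_proj core (i x).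

Lemma val_core_incl x : val (core_incl_fun x) = i x.
Proof. exact: core_incl. Qed.

Lemma core_incl_inj : injective core_incl_fun.
Proof.
by move=> x y /(congr1 val); rewrite !val_core_incl => /incl_inj.
Qed.

Lemma core_incl_generates (t : fixpoints core) :
  exists A : set L, t = bigmeet (core_incl_fun @` A).
Proof.
have [A tE] := incl_generates (val t); exists A.
by rewrite -[LHS]fix_projK tE fix_proj_bigmeet image_comp.
Qed.

Lemma core_incl_bigjoin A :
  core_incl_fun (bigjoin A) = bigjoin (core_incl_fun @` A).
Proof.
apply: val_inj; rewrite val_core_incl val_fix_bigjoin incl_bigjoin image_comp.
by congr bigjoin; apply: eq_imagel => x _; rewrite -[LHS]val_core_incl.
Qed.

Lemma core_incl_top : core_incl_fun \top = \top.
Proof. by rewrite /core_incl_fun incl_top. Qed.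

Lemma core_incl_meet : {morph core_incl_fun : x y / Order.meet x y}.
Proof.
move=> x y; rewrite /core_incl_fun incl_meet -!bigmeet_set2.
by rewrite fix_proj_bigmeet image_setU !image_set1.
Qed.

Lemma core_incl_strongly_exact A : strongly_exact_meet A ->
  core_incl_fun (bigmeet A) = bigmeet (core_incl_fun @` A).
Proof.
move=> seA; rewrite /core_incl_fun incl_strongly_exact //.
by rewrite fix_proj_bigmeet image_comp.
Qed.

Definition core_ext : raney_ext :=
  RaneyExt core_incl_inj core_incl_generates core_incl_bigjoin core_incl_top
    core_incl_meet core_incl_strongly_exact.

Lemma frame_map_id : frame_map (@id L).
Proof. by split=> // A; rewrite image_id. Qed.

Definition core_hom : raney_hom X core_ext :=
  @RaneyHom X core_ext (fix_proj core) id (fix_proj_coframe_map core)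
    (fun=> erefl) frame_map_id.

Lemma core_hom_exact : exact_hom core_hom.
Proof. by move=> A exA; rewrite image_id. Qed.

Lemma core_ext_TD : raney_TD core_ext.
Proof.
move=> t; exists [set F | exists a b,
  F = [set z | cdiff (i b) (i a) <= i z] /\ cdiff (i b) (i a) <= val t].
split; first by move=> _ [a [b [-> _]]]; apply: exact_filter_cdiff.
have meetE b a : bigmeet (core_incl_fun @` [set z | cdiff (i b) (i a) <= i z])
    = fix_proj core (cdiff (i b) (i a)).
  by rewrite -[X in _ = fix_proj _ X]bigmeet_above fix_proj_bigmeet image_comp.
apply: val_inj; rewrite val_fix_bigjoin -[LHS](fixpointE t) /=.
congr bigjoin; apply/seteqP; split=> [_ [a [b [-> le_t]]]|e] /=.
  exists (fix_proj core (cdiff (i b) (i a))); last exact: core_cdiff.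
  by exists [set z | cdiff (i b) (i a) <= i z]; [exists a, b|exact: meetE].
move=> [_ [_ [a [b [-> le_t]]] <-] <-]; exists a, b.
rewrite meetE; split; first exact: core_cdiff.
exact: le_trans (core_fun_le _) le_t.
Qed.

(** As [t] is the meet of the [a] in [L] above it, its complement is [t'], the
    join of the [1 \ a].  If a difference below both were nonzero, subfitness
    would yield [v <> 1] in [L] with [1 \ v] below both.  Then [v \/ a = 1], or
    [1 \ a <= v], for every [a >= t], so [t' <= v] and [1 \ v <= v], which
    forces [v = 1]. *)
Lemma core_ext_T1 : subfit L -> raney_T1 core_ext.
Proof.
move=> sfL t.
pose t' := bigjoin [set cdiff \top (i a) | a in [set a | val t <= i a]].
exists (fix_proj core t').
have fix_t' : core t' = t'.
  apply/le_anti; rewrite conucleus_le /=; apply: bigjoin_le => _ [a ta <-].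
  by rewrite -incl_top cdiff_le_core incl_top; apply: bigjoin_ub; exists a.
split; last first.
  apply: val_inj; rewrite val_fixU !val_fix_proj fix_t'.
  rewrite -incl_top core_incl incl_top.
  apply/le_anti; rewrite lex1 /= joinC -[val t]bigmeet_above join_bigmeet.
  apply: bigmeet_ge => _ [_ [a ta <-] <-]; rewrite joinC -cdiff_le.
  by apply: bigjoin_ub; exists a.
apply/le_anti; rewrite le0x andbT [X in X <= _](_ : _ = fix_proj core
  (Order.meet (val t) (core t'))) // fix_t'.
apply: le_trans (_ : _ <= core \bot) _; last by [].
rewrite -incl0 core_incl; apply: core_fun_leP => a b.
rewrite lexI cdiff_incl_le join0x => /andP[le_t le_t'].
apply/negPn/negP => /negP /sfL [u [bu au]]; apply: au.
set v := Order.join a u.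
have v_diff : cdiff (i \top) (i v) <= cdiff (i b) (i a).
  apply: le_bigmeet_above => z; rewrite !cdiff_incl_le -bu => ba.
  by rewrite leUx (le_trans ba) /v ?leU2 ?leUl // joinA leUr.
(* By v_diff, 1 \ v lies below t', so t' <= v would give 1 \ v <= v. *)
suff t'v : t' <= i v.
  apply/le_anti; rewrite lex1 /= -[v]joinxx -cdiff_incl_le.
  by apply: le_trans v_diff (le_trans le_t' t'v).
apply: bigjoin_le => _ [x tx <-].
rewrite -incl_top cdiff_incl_le joinC -cdiff_incl_le.
by apply: le_trans v_diff (le_trans le_t tx).
Qed.

(** If [c'] is a complement of [c] and the meet of the elements [x >= c'] of
    [L], then [c] is the join of the differences [1 \ x], each of which is the
    meet of an exact filter. *)
Lemma T1_TD : raney_T1 X -> raney_TD X.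
Proof.
move=> T1X c; have [c' [cc'0 cc'1]] := T1X c.
exists [set F | exists2 x, c' <= i x &
  F = [set z | cdiff (i \top) (i x) <= i z]].
split; first by move=> _ [x _ ->]; apply: exact_filter_cdiff.
set S := [set _ | _ in _]; apply/le_anti/andP; split; last first.
  apply: bigjoin_le => _ [_ [x c'x ->] <-]; rewrite bigmeet_above cdiff_le.
  by rewrite incl_top -cc'1 joinC leU2.
have Sc' : Order.join (bigjoin S) c' = \top.
  apply/le_anti; rewrite lex1 /= -[c']bigmeet_above join_bigmeet.
  apply: bigmeet_ge => _ [_ [x c'x <-] <-]; rewrite joinC -incl_top -cdiff_le.
  apply: bigjoin_ub; exists [set z | cdiff (i \top) (i x) <= i z].
    by exists x.
  exact: bigmeet_above.
by rewrite -[leRHS]joinx0 -cc'0 join_meetr Sc' meetx1 leUr.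
Qed.

End RaneyTheory.

(** * The universal property *)

Lemma frame_map_mono d d' (L : frameType d) (M : frameType d') (g : L -> M) :
  frame_map g -> {homo g : x y / x <= y}.
Proof.
by move=> gF x y; rewrite !leEmeet -(frame_map_meet gF) => /eqP ->.
Qed.

Lemma coframe_map_mono d d' (C : coframeType d) (D : coframeType d')
  (f : C -> D) : coframe_map f -> {homo f : x y / x <= y}.
Proof.
by move=> fC x y; rewrite !leEjoin -(coframe_map_join fC) => /eqP ->.
Qed.

Lemma exact_filter_preimage d d' (L : frameType d) (M : frameType d')
    (g : L -> M) (G : set M) :
  frame_map g -> exact_map g -> exact_filter G -> exact_filter (g @^-1` G).
Proof.
move=> gF gE [[G1 GI Gup] GE]; split; first split.
- by rewrite /= (frame_map_top gF).
- by move=> x y Gx Gy; rewrite /= (frame_map_meet gF); apply: GI.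
- by move=> x y xy; apply: Gup; apply: frame_map_mono.
move=> A GA /gE [exgA gAE]; rewrite /preimage /= -gAE; apply: GE exgA.
by move=> _ [x Ax <-]; apply: GA.
Qed.

(** Exact filters of the target pull back to exact filters of the source, and
    these contain the elements above [c] iff they contain those above
    [core X c]. *)
Lemma hom_core (X Y : raney_ext) (f : raney_hom X Y) c :
  exact_hom f -> raney_TD Y -> f (core X c) = f c.
Proof.
move=> fE TDY; have fmono := coframe_map_mono (hom_coframe_map f).
apply/le_anti; rewrite (fmono _ _ (conucleus_le _ _)) andTb.
have [S [exS fcE]] := TDY (f c).
rewrite fcE; apply: bigjoin_le => _ [G SG <-].
have exG := exS _ SG; pose E := hom_restr f @^-1` G.
have exE : exact_filter E := exact_filter_preimage (hom_frame_map f) fE exG.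
have Ec : bigmeet (incl X @` E) <= c.
  apply: le_bigmeet_above => x cx; apply: bigmeet_lb; exists x => //.
  apply: (mem_exact_filter exG); rewrite -hom_restrE.
  apply: le_trans (fmono _ _ cx).
  by rewrite fcE; apply: bigjoin_ub; exists G.
rewrite -[core X c]bigmeet_above (coframe_map_bigmeet (hom_coframe_map f)).
apply: bigmeet_ge => _ [_ [x cx <-] <-]; rewrite hom_restrE.
apply: bigmeet_lb; exists (hom_restr f x) => //.
apply: (mem_exact_filter_core exE); apply: le_trans cx.
exact: conucleus_mono.
Qed.

Section Factorization.
Variables (X Y : raney_ext) (f : raney_hom X Y).
Hypothesis f_core : forall c, f (core X c) = f c.

Definition factor_fun (t : coframe_of (core_ext X)) : coframe_of Y := f (val t).

Lemma factor_coframe_map : coframe_map factor_fun.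
Proof.
have fC := hom_coframe_map f; split.
- move=> A; rewrite /factor_fun /= f_core (coframe_map_bigmeet fC).
  by rewrite image_comp.
- by rewrite /factor_fun /= f_core (coframe_map_bot fC).
- by move=> s t; rewrite /factor_fun val_fixU (coframe_map_join fC).
Qed.

Lemma factor_restrE x :
  factor_fun (incl (core_ext X) x) = incl Y (hom_restr f x).
Proof. by rewrite /factor_fun /= f_core hom_restrE. Qed.

Definition factor_hom : raney_hom (core_ext X) Y :=
  RaneyHom factor_coframe_map factor_restrE (hom_frame_map f).

Lemma factor_homE : f =1 factor_hom \o core_hom X.
Proof. by move=> c; rewrite /= /factor_fun /= f_core. Qed.

End Factorization.

Lemma core_hom_universal (X Y : raney_ext) (f : raney_hom X Y) :
    exact_hom f -> raney_TD Y ->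
  exists2 g : raney_hom (core_ext X) Y, exact_hom g & f =1 g \o core_hom X.
Proof.
move=> fE TDY; have f_core c := hom_core c fE TDY.
by exists (factor_hom f_core) => //; apply: factor_homE.
Qed.

Theorem proposition4p14 (X : raney_ext) (hX : subfit (frame_of X)) :
  exists (T : raney_ext) (tau : raney_hom X T),
    reflection_E raney_T1 tau /\ reflection_E raney_TD tau.
Proof.
exists (core_ext X), (core_hom X); split; split.
- exact: core_hom_exact.
- exact: core_ext_T1.
- by move=> Y f fE /T1_TD; apply: core_hom_universal.
- exact: core_hom_exact.
- exact: core_ext_TD.
- exact: core_hom_universal.
Qed.
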